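(* Let $\alpha\ge0$. Assume $(\mathrm{A}_1)$–$(\mathrm{A}_3)$ as spelled out in the context, let $(\gamma_k)_{k\ge1}$ be a non-increasing sequence of positive regularization parameters with associated regularizations $\mathcal{R}_{\gamma_k}$ of $\mathcal{R}$, with exponent $\sigma>0$, and let $\eta>0$. Suppose there are $\omega\in(0,1)$ and $C_0>0$ such that $\gamma_{k-1}^\sigma/\gamma_k\le C_0\omega^k$ for all $k\ge2$. Then there is a constant $C>0$, independent of $\varepsilon$ and $k$, such that for every $\varepsilon\in(0,1)$ for which, with $M=\eta+\varepsilon^\alpha\delta_1$, $$\overline\omega:=\omega+\sqrt{\frac{M}{\underline\gamma C_p^{-1}+M}}<1,$$ the iterates $u_\varepsilon^k$ and the unique weak solution $u_\varepsilon$ of $(P_\varepsilon)$ satisfy, for all $k\ge1$, $$\sqrt{\frac{\underline\gamma}{\eta+\delta_1+\underline\gamma C_p^{-1}}}\,\left\|\nabla(u_\varepsilon-u_\varepsilon^k)\right\|_{L^2(\Omega^\varepsilon)}+\left\|u_\varepsilon-u_\varepsilon^k\right\|_{L^2(\Omega^\varepsilon)}\le\frac{C\,\overline\omega^{\,k}}{1-\overline\omega}.$$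
   Context: Geometry. Let $d\in\{2,3\}$, $\Omega\subset\mathbb{R}^d$ a bounded polygonal (polyhedral) domain, $Y=[0,1]^d$ the periodicity cell. $Y_l\subset Y$ is the pore part of the cell, i.e. $Y$ minus a hole with Lipschitz boundary $\Gamma$. For $\varepsilon\in(0,1)$, $\Omega^\varepsilon\subset\Omega$ is the perforated domain obtained from $\Omega$ by removing $\varepsilon$-scaled, $\varepsilon$-periodically repeated copies of the hole; it is bounded, connected, and has Lipschitz boundary $\partial\Omega^\varepsilon=\Gamma^\varepsilon\cup\Gamma^{\mathrm{ext}}$, where $\Gamma^\varepsilon$ is the union of the boundaries of the removed holes and $\Gamma^{\mathrm{ext}}=\partial\Omega$ is the exterior boundary. Function space. $V^\varepsilon=\{u\in H^1(\Omega^\varepsilon):u=0\text{ on }\Gamma^{\mathrm{ext}}\}$. $C_p>0$ is a constant independent of $\varepsilon$ with $\|u\|^2_{L^2(\Omega^\varepsilon)}\le C_p\|\nabla u\|^2_{L^2(\Omega^\varepsilon)}$ for all $u\in V^\varepsilon$ (such a constant exists). Degenerate function. A function $F:\mathbb{R}\to\mathbb{R}$ is degenerate at $x_0\in\mathbb{R}$ if there is $\delta_1>0$ with $0\le F'(x)\le\delta_1$ for a.e. $x\in\mathbb{R}$ and: (i) if $\lim_{x\to s^+}F'(x)\lim_{x\to s^-}F'(x)=0$ for some $s\in\mathbb{R}$, then $s=x_0$; (ii) there exist $\delta_0,r_{x_0}>0$ with $0<\delta_0\le F'(x)\le\delta_1$ for a.e. $x\in\mathbb{R}\setminus\mathcal{B}(x_0,r_{x_0})$,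 where $\mathcal{B}(x_0,r_{x_0})$ is the ball of center $x_0$ and radius $r_{x_0}$; (iii) $F'$ is non-decreasing on $\overline{\mathcal{B}(x_0,r_{x_0})}$. Regularization. For such $F$ (with constants $\delta_0,\delta_1$) and $\gamma>0$, a regularization $F_\gamma:\mathbb{R}\to\mathbb{R}$ of $F$ satisfies $0<\gamma\delta_0\le F_\gamma'(x)\le\delta_1$ and $|F(x)-F_\gamma(x)|\le C\gamma^\sigma$ for all $x\in\mathbb{R}$, where $\sigma>0$ and $C>0$ do not depend on $\gamma$ or $x$. Existence of such regularizations of $\mathcal{R}$ is assumed. Assumptions. $(\mathrm{A}_1)$ $\mathbf{A}=(a_{ij}):Y\to\mathbb{R}^{d\times d}$ is essentially bounded, $Y$-periodic, symmetric, globally Lipschitz, and there are $\varepsilon$-independent $\underline\gamma,\overline\gamma>0$ with $\underline\gamma|\xi|^2\le\sum_{i,j}a_{ij}(x/\varepsilon)\xi_i\xi_j\le\overline\gamma|\xi|^2$ for all $\xi\in\mathbb{R}^d$. $(\mathrm{A}_2)$ $\mathcal{R}:\mathbb{R}\to\mathbb{R}$ is degenerate at some point, with constants $\delta_0,\delta_1$. $(\mathrm{A}_3)$ $f\in L^2(\Omega)$. Microscopic problem $(P_\varepsilon)$: $\nabla\cdot(-\mathbf{A}(x/\varepsilon)\nabla u_\varepsilon)+\varepsilon^\alpha\mathcal{R}(u_\varepsilon)=f$ in $\Omega^\varepsilon$, $-\mathbf{A}(x/\varepsilon)\nabla u_\varepsilon\cdot n=0$ on $\Gamma^\varepsilon$,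 $u_\varepsilon=0$ on $\Gamma^{\mathrm{ext}}$. A weak solution is $u_\varepsilon\in H^1(\Omega^\varepsilon)$ with $u_\varepsilon=0$ on $\Gamma^{\mathrm{ext}}$ such that $\int_{\Omega^\varepsilon}\mathbf{A}(x/\varepsilon)\nabla u_\varepsilon\cdot\nabla\varphi\,dx+\varepsilon^\alpha\int_{\Omega^\varepsilon}\mathcal{R}(u_\varepsilon)\varphi\,dx=\int_{\Omega^\varepsilon}f\varphi\,dx$ for all $\varphi\in V^\varepsilon$. Under the hypotheses of the claim it exists and is unique. Iteration. $u_\varepsilon^0=0$, and for $k\ge1$, $u_\varepsilon^k\in V^\varepsilon$ is the unique solution of $$\int_{\Omega^\varepsilon}\mathbf{A}(x/\varepsilon)\nabla u_\varepsilon^k\cdot\nabla\varphi\,dx+M\int_{\Omega^\varepsilon}u_\varepsilon^k\varphi\,dx=\int_{\Omega^\varepsilon}f\varphi\,dx+M\int_{\Omega^\varepsilon}u_\varepsilon^{k-1}\varphi\,dx-\varepsilon^\alpha\int_{\Omega^\varepsilon}\mathcal{R}_{\gamma_k}(u_\varepsilon^{k-1})\varphi\,dx\quad\text{for all }\varphi\in V^\varepsilon.$$ *)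

(* Defs.v *)
From HB Require Import structures.
From mathcomp Require Import all_boot all_order all_algebra.
From mathcomp Require Import all_classical all_reals all_analysis.

Set Implicit Arguments.
Unset Strict Implicit.
Unset Printing Implicit Defensive.

Import Order.TTheory GRing.Theory Num.Theory.
Import numFieldNormedType.Exports.

Local Open Scope classical_set_scope.
Local Open Scope ring_scope.

(* Points and vectors of R^n are row vectors 'rV[R]_n; the library norm on them
   is the sup norm, hence the explicit Euclidean product dotp below. *)

(* The sigma-algebra of R^n generated by the n coordinates, i.e. the Borel
   sigma-algebra. *)
Section rV_measurable.
Context {R : realType} (n : nat).

Definition rV_coord (i : 'I_n) (x : 'rV[R]_n) : R := x ord0 i.

Let rV_set0 : g_sigma_preimage rV_coord set0.
Proof. exact: sigma_algebra0. Qed.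

Let rV_setC A : g_sigma_preimage rV_coord A -> g_sigma_preimage rV_coord (~` A).
Proof. exact: sigma_algebraC. Qed.

Let rV_bigcup (F : _^nat) : (forall i, g_sigma_preimage rV_coord (F i)) ->
  g_sigma_preimage rV_coord (\bigcup_i (F i)).
Proof. exact: sigma_algebra_bigcup. Qed.

HB.instance Definition _ := @isMeasurable.Build default_measure_display
  'rV[R]_n (g_sigma_preimage rV_coord) rV_set0 rV_setC rV_bigcup.

Lemma measurable_fun_rVP d (T : measurableType d) (f : T -> 'rV[R]_n) :
  (forall i, measurable_fun [set: T] (fun t => f t ord0 i)) ->
  measurable_fun [set: T] f.
Proof.
move=> mf; suff H : g_sigma_preimage (fun i => rV_coord i \o f) `<=` measurable.
  by move=> _ A mA; apply: H; rewrite g_sigma_preimage_comp; exists A.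
apply: smallest_sub; first exact: sigma_algebra_measurable.
elim/big_ind : _ => [//|B C HB HC A [/HB|/HC]//|i _].
by move=> A [B mB <-]; exact: mf.
Qed.

Lemma measurable_rV_coord (i : 'I_n) :
  measurable_fun [set: 'rV[R]_n] (fun x : 'rV[R]_n => x ord0 i).
Proof.
move=> _ Y mY; rewrite setTI; apply: sub_sigma_algebra => /=.
rewrite -bigcup_seq/=; exists i => /=; first by rewrite mem_index_enum.
by exists Y => //; rewrite setTI.
Qed.

End rV_measurable.

Section lebesgue_rV_step.
Context {R : realType} (n : nat).
Variable mu : {sigma_finite_measure set 'rV[R]_n -> \bar R}.

Definition rV_cons (p : measurableTypeR R * 'rV[R]_n) : 'rV[R]_n.+1 :=
  \row_i oapp (fun j => p.2 ord0 j) p.1 (unlift ord0 i).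

Lemma measurable_rV_cons : measurable_fun setT rV_cons.
Proof.
apply: measurable_fun_rVP => i; case: (unliftP ord0 i) => [j ->|->].
  under eq_fun do rewrite mxE liftK /=.
  exact: (measurableT_comp (measurable_rV_coord j) measurable_snd).
under eq_fun do rewrite mxE unlift_none /=.
exact: measurable_fst.
Qed.

Definition lebesgue_rV_step : set 'rV[R]_n.+1 -> \bar R :=
  pushforward (lebesgue_measure \x mu)%E rV_cons.

Let preimage_rV_cons A : measurable A -> measurable (rV_cons @^-1` A).
Proof. by move=> mA; rewrite -[X in measurable X]setTI; exact: measurable_rV_cons. Qed.

Let step0 : lebesgue_rV_step set0 = 0%E.
Proof. by rewrite /lebesgue_rV_step /pushforward preimage_set0 measure0. Qed.

Let step_ge0 A : (0 <= lebesgue_rV_step A)%E.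
Proof. by rewrite /lebesgue_rV_step /pushforward measure_ge0. Qed.

Let step_sigma_additive : semi_sigma_additive lebesgue_rV_step.
Proof.
move=> F mF tF mUF; rewrite /lebesgue_rV_step /pushforward preimage_bigcup.
apply: measure_semi_sigma_additive.
- by move=> k; exact: preimage_rV_cons.
- apply/trivIsetP => /= i j _ _ ij; rewrite -preimage_setI.
  by move/trivIsetP : tF => /(_ _ _ _ _ ij) ->//; rewrite preimage_set0.
- by rewrite -preimage_bigcup; exact: preimage_rV_cons.
Qed.

HB.instance Definition _ := isMeasure.Build _ _ _ lebesgue_rV_step
  step0 step_ge0 step_sigma_additive.

Let rV_uncons (x : 'rV[R]_n.+1) : measurableTypeR R * 'rV[R]_n :=
  (x ord0 ord0, \row_j x ord0 (lift ord0 j)).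

Let measurable_rV_uncons : measurable_fun setT rV_uncons.
Proof.
apply: measurable_fun_pair; first exact: measurable_rV_coord.
apply: measurable_fun_rVP => i; under eq_fun do rewrite mxE.
exact: measurable_rV_coord.
Qed.

Let rV_consK : cancel rV_cons rV_uncons.
Proof.
move=> [a x]; rewrite /rV_uncons !mxE unlift_none /=; congr pair.
by apply/rowP => j; rewrite !mxE liftK.
Qed.

Let step_sigma_finite : sigma_finite setT lebesgue_rV_step.
Proof.
have /sigma_finiteP[F [TF ndF Foo]] := sigma_finiteT (@lebesgue_measure R).
have /sigma_finiteP[G [TG ndG Goo]] := sigma_finiteT mu.
exists (fun k => rV_uncons @^-1` (F k `*` G k)).
  rewrite -preimage_bigcup (_ : \bigcup_k _ = setT) ?preimage_setT//.
  rewrite -subTset -setXTT TF TG => -[x y] [/= [a _ Fax] [b _ Gby]].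
  exists (maxn a b) => //; split.
    by move: x Fax; exact/subsetPset/ndF/leq_maxl.
  by move: y Gby; exact/subsetPset/ndG/leq_maxr.
move=> k; have [mF Fk] := Foo k; have [mG Gk] := Goo k; split.
  by rewrite -[X in measurable X]setTI; apply: measurable_rV_uncons => //;
    exact: measurableX.
rewrite /lebesgue_rV_step /pushforward -comp_preimage.
rewrite (_ : rV_uncons \o rV_cons = id); last exact/funext.
by rewrite preimage_id product_measure1E// lte_mul_pinfty// ge0_fin_numE.
Qed.

HB.instance Definition _ := Measure_isSigmaFinite.Build _ _ _ lebesgue_rV_step
  step_sigma_finite.

End lebesgue_rV_step.

(* n-dimensional Lebesgue measure: the product of n copies of the
   one-dimensional one. *)
Fixpoint leb {R : realType} (n : nat) :
    {sigma_finite_measure set 'rV[R]_n -> \bar R} :=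
  match n with
  | 0 => \d_(0 : 'rV[R]_0)
  | m.+1 => lebesgue_rV_step (@leb R m)
  end.

Section euclidean.
Context {R : realType} {d : nat}.
Implicit Types (E : set 'rV[R]_d) (x y : 'rV[R]_d).

Definition dotp x y : R := \sum_(i < d) x ord0 i * y ord0 i.

Definition boundary E : set 'rV[R]_d := closure E `\` interior E.

(* Near each boundary point p there is a unit vector nu such that, writing
   x = y + s nu with y orthogonal to nu, the interior of E is the part s > phi y
   lying above the graph of a Lipschitz function phi and the boundary is the
   graph itself (only the values of phi on the hyperplane orthogonal to nu
   matter). *)
Definition lipschitz_boundary E : Prop :=
  forall p, boundary E p ->
  exists (r : R) (nu : 'rV[R]_d) (phi : 'rV[R]_d -> R^o),
    [/\ 0 < r, dotp nu nu = 1, lipschitz phi &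
        forall x, ball p r x ->
          let s := dotp x nu in let y := x - s *: nu in
          (interior E x <-> phi y < s) /\ (boundary E x <-> s = phi y)].

(* A half-space {x | a.x <= b} is encoded by the pair (a, b), a polytope by the
   list of the half-spaces of which it is the intersection. *)
Definition polytope (hs : seq ('rV[R]_d * R)) : set 'rV[R]_d :=
  [set x | forall h, h \in hs -> dotp h.1 x <= h.2].

(* For d = 2 (resp. 3): bounded polygonal (resp. polyhedral) domain. *)
Definition bounded_polyhedral_domain E : Prop :=
  [/\ E !=set0, open E, connected E, bounded_set E &
      E = interior (closure E) /\
      exists ps : seq (seq ('rV[R]_d * R)),
        closure E = [set x | exists2 hs, hs \in ps & polytope hs x]].

Definition unit_cell : set 'rV[R]_d :=
  [set x | forall i, 0 <= x ord0 i <= 1].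

(* The pore part of the cell is unit_cell `\` T. *)
Definition is_hole (T : set 'rV[R]_d) : Prop :=
  [/\ T !=set0, compact T, T `<` unit_cell & lipschitz_boundary T].

Definition hole_copy (eps : R) (T : set 'rV[R]_d) (k : 'rV[int]_d) :
    set 'rV[R]_d :=
  [set eps *: (map_mx intr k + y) | y in T].

Definition perforated (eps : R) (K : set 'rV[int]_d) (Omega T : set 'rV[R]_d) :
    set 'rV[R]_d :=
  Omega `\` \bigcup_(k in K) hole_copy eps T k.

Definition hole_boundaries (eps : R) (K : set 'rV[int]_d) (T : set 'rV[R]_d) :
    set 'rV[R]_d :=
  \bigcup_(k in K) boundary (hole_copy eps T k).

(* K eps is the set of the cells whose hole is removed at scale eps. *)
Definition perforation (Omega T : set 'rV[R]_d) (K : R -> set 'rV[int]_d) :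
    Prop :=
  forall eps, 0 < eps < 1 ->
    [/\ forall k, K eps k -> hole_copy eps T k `<=` Omega,
        connected (perforated eps (K eps) Omega T),
        lipschitz_boundary (perforated eps (K eps) Omega T) &
        boundary (perforated eps (K eps) Omega T) =
          hole_boundaries eps (K eps) T `|` boundary Omega].

End euclidean.

Section sobolev.
Context {R : realType} {d : nat}.
Implicit Types (O Gam : set 'rV[R]_d) (u v phi : 'rV[R]_d -> R).
Implicit Types (g h : 'rV[R]_d -> 'rV[R]_d).

Definition partial (i : 'I_d) (u : 'rV[R]_d -> R) : 'rV[R]_d -> R :=
  fun x => 'D_(delta_mx ord0 i) (u : 'rV[R]_d -> R^o) x.

Definition grad (u : 'rV[R]_d -> R) : 'rV[R]_d -> 'rV[R]_d :=
  fun x => \row_i partial i u x.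

Definition iter_partial (s : seq 'I_d) (u : 'rV[R]_d -> R) : 'rV[R]_d -> R :=
  foldr partial u s.

Definition smooth phi : Prop :=
  forall s : seq 'I_d,
    continuous (iter_partial s phi : 'rV[R]_d -> R^o) /\
    forall i x, derivable (iter_partial s phi : 'rV[R]_d -> R^o) x
                          (delta_mx ord0 i).

Definition test_function O phi : Prop :=
  smooth phi /\
  exists C : set 'rV[R]_d,
    [/\ compact C, C `<=` O & forall x, ~ C x -> phi x = 0].

Definition L2 O u : Prop :=
  measurable_fun O u /\ (@leb R d).-integrable O (fun x => (u x ^+ 2)%:E).

Definition L2vec O g : Prop := forall i, L2 O (fun x => g x ord0 i).

Definition L2norm O u : R :=
  Num.sqrt (\int[@leb R d]_(x in O) (u x ^+ 2)).

Definition L2norm_vec O g : R :=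
  Num.sqrt (\int[@leb R d]_(x in O) dotp (g x) (g x)).

Definition weak_gradient O u g : Prop :=
  forall phi, test_function O phi -> forall i,
    \int[@leb R d]_(x in O) (u x * partial i phi x) =
    - \int[@leb R d]_(x in O) (g x ord0 i * phi x).

(* H1 O u g: u belongs to H^1(O) and (a representative of) its weak gradient
   is g. The weak gradient is unique up to a null set; an element of H^1(O) is
   handled through the pair (u, g), so that the gradient of a difference is the
   difference of the second components. *)
Definition H1 O u g : Prop := [/\ L2 O u, L2vec O g & weak_gradient O u g].

(* u = 0 on the part Gam of the boundary of O: u is the limit in H^1(O) of
   smooth functions that vanish in a neighbourhood of Gam. *)
Definition zero_on O Gam u g : Prop :=
  forall e : R, 0 < e ->
  exists phi,
    [/\ smooth phi,
        exists U : set 'rV[R]_d,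
          [/\ open U, Gam `<=` U & forall x, U x -> phi x = 0] &
        L2norm O (fun x => u x - phi x) +
        L2norm_vec O (fun x => g x - grad phi x) < e].

Definition H1_0 O Gam u g : Prop := H1 O u g /\ zero_on O Gam u g.

Definition poincare O Gam (Cp : R) : Prop :=
  forall u g, H1_0 O Gam u g ->
    L2norm O u ^+ 2 <= Cp * L2norm_vec O g ^+ 2.

End sobolev.

Section degenerate.
Context {R : realType}.
Implicit Types (F G : R -> R).

(* F' is only available almost everywhere: its one-sided limits, and its
   monotonicity, are taken along the points at which F is differentiable. *)
Definition degenerate_at F (x0 delta0 delta1 : R) : Prop :=
  let dF := derivable (F : R -> R^o)^~ 1 in
  let F' := derive1 (F : R -> R^o) in
  [/\ 0 < delta1,
      {ae @lebesgue_measure R, forall x, dF x /\ 0 <= F' x <= delta1},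
      forall s lr ll : R,
        F' x @[x --> within dF s^'+] --> lr ->
        F' x @[x --> within dF s^'-] --> ll ->
        lr * ll = 0 -> s = x0 &
      0 < delta0 /\ exists r : R,
        [/\ 0 < r,
            {ae @lebesgue_measure R, forall x, ~ ball x0 r x ->
               dF x /\ delta0 <= F' x <= delta1} &
            forall x y, closed_ball x0 r x -> closed_ball x0 r y ->
              dF x -> dF y -> x <= y -> F' x <= F' y]].

Definition regularization F (delta0 delta1 sigma C gamma : R) G : Prop :=
  (forall x, derivable (G : R -> R^o) x 1 /\
     0 < gamma * delta0 <= derive1 (G : R -> R^o) x /\
     derive1 (G : R -> R^o) x <= delta1) /\
  (forall x, `|F x - G x| <= C * gamma `^ sigma).

End degenerate.

Section problem.
Context {R : realType} {d : nat}.
Implicit Types (A : 'rV[R]_d -> 'M[R]_d) (O Gam : set 'rV[R]_d).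
Implicit Types (u v f : 'rV[R]_d -> R) (g h : 'rV[R]_d -> 'rV[R]_d).

(* A is identified with its periodic extension to the whole space. *)
Definition admissible_coefficient A (glo ghi : R) : Prop :=
  [/\ exists C : R, {ae @leb R d, forall x, forall i j, `|A x i j| <= C},
      forall x i, A (x + delta_mx ord0 i) = A x,
      forall x, (A x)^T = A x,
      lipschitz A &
      [/\ 0 < glo, 0 < ghi &
        forall eps, 0 < eps < 1 -> forall x xi : 'rV[R]_d,
          glo * dotp xi xi <=
            \sum_i \sum_j A (eps^-1 *: x) i j * xi ord0 i * xi ord0 j /\
          \sum_i \sum_j A (eps^-1 *: x) i j * xi ord0 i * xi ord0 j <=
            ghi * dotp xi xi]].

(* the integral over O of A(x/eps) g . h, where g and h are gradients *)
Definition diffusion_form A (eps : R) O g h : R :=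
  \int[@leb R d]_(x in O)
    \sum_i \sum_j A (eps^-1 *: x) i j * g x ord0 j * h x ord0 i.

Definition L2prod O u v : R := \int[@leb R d]_(x in O) (u x * v x).

Definition weak_solution A (eps alpha : R) (Rr : R -> R) f O Gam u g : Prop :=
  H1_0 O Gam u g /\
  forall v h, H1_0 O Gam v h ->
    diffusion_form A eps O g h + eps `^ alpha * L2prod O (Rr \o u) v =
    L2prod O f v.

Definition iteration_step A (eps alpha M : R) (Rk : R -> R) f O Gam uprev u g :
    Prop :=
  H1_0 O Gam u g /\
  forall v h, H1_0 O Gam v h ->
    diffusion_form A eps O g h + M * L2prod O u v =
    L2prod O f v + M * L2prod O uprev v -
      eps `^ alpha * L2prod O (Rk \o uprev) v.

Definition iterates A (eps alpha M : R) (Rg : nat -> R -> R) f O Gam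
    (uk : nat -> 'rV[R]_d -> R) (gk : nat -> 'rV[R]_d -> 'rV[R]_d) : Prop :=
  uk 0%N = (fun=> 0) /\
  forall k, (1 <= k)%N ->
    iteration_step A eps alpha M (Rg k) f O Gam (uk k.-1) (uk k) (gk k).

End problem.

(* Main.v *)
Require Import Defs.
From mathcomp Require Import all_boot all_order all_algebra.
From mathcomp Require Import all_classical all_reals all_analysis.
From mathcomp Require Import measurable_realfun.
From mathcomp Require Import ring lra.

Set Implicit Arguments.
Unset Strict Implicit.
Unset Printing Implicit Defensive.

Import Order.TTheory GRing.Theory Num.Theory.
Import numFieldNormedType.Exports.

Local Open Scope classical_set_scope.
Local Open Scope ring_scope.

(* The hypothesis on gamma_{k-1}^sigma / gamma_k makes gamma_k^sigma = O(omega^k),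
   so Rr is the uniform limit of its regularizations and inherits from them
   monotonicity and the Lipschitz constant delta1. Put e_k = u - u_k. Testing the
   difference of the two weak formulations with e_k gives
     glo |grad e_k|^2 + M |e_k|^2 <= (M |e_{k-1}| + O(omega^k)) |e_k|,
   because s |-> M s - eps^alpha Rr s is M-Lipschitz. With Poincare's inequality
   and q = sqrt (M / (glo / Cp + M)), so that q^2 <= q, this yields
     |e_k| <= q |e_{k-1}| + O(omega^k),
   hence |e_k| = O((omega + q)^k) by induction, and the same inequality bounds
   grad e_k. The constants are uniform in eps because |e_0| = |u| is bounded by
   testing the equation of u with u itself. *)

(** * Borel sets and Borel functions on the space of row vectors *)

Section rV_borel.
Context {R : realType} (d : nat).
Implicit Types (U : set 'rV[R]_d).

Lemma measurable_rV_box (I : 'I_d -> set R) : (forall i, measurable (I i)) ->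
  measurable [set x : 'rV[R]_d | forall i, I i (x ord0 i)].
Proof.
move=> mI.
rewrite [X in measurable X](_ : _ =
    \bigcap_(i in [set: 'I_d]) ((fun x : 'rV[R]_d => x ord0 i) @^-1` I i)).
  apply: fin_bigcap_measurable => [|i _]; first exact: finite_finset.
  by rewrite -[X in measurable X]setTI; exact: measurable_rV_coord.
by apply/seteqP; split => x /=; [move=> h i _; exact: h|move=> h i; exact: h].
Qed.

(** The sigma-algebra is generated by the coordinates, so it contains boxes; for the sup norm these
    are the balls, and countably many with rational centres and radii [1 / (n + 1)] exhaust an open
    set. *)
Lemma open_measurable_rV U : open U -> measurable U.
Proof.
move=> oU.
pose B (p : 'rV[rat]_d * nat) : set 'rV[R]_d :=
  [set x | forall i, ball (ratr (p.1 ord0 i) : R) p.2.+1%:R^-1 (x ord0 i)].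
(* Boxes that leave [U] are replaced by the empty set, so that the union runs over a whole countable
   type. *)
pose F p := if `[< B p `<=` U >] then B p else set0.
have -> : U = \bigcup_p F p.
  apply/seteqP; split => [x Ux|x [p _]]; last first.
    by rewrite /F; case: asboolP => // BU /BU.
  have /nbhs_ballP[e /= e0 eU] := open_nbhs_nbhs (conj oU Ux).
  (* A box of radius [1 / (n + 1)] around a rational point that close to [x] lies within
     [2 / (n + 1) < e] of [x]. *)
  pose n := Num.truncn (2 / e).
  have n0 : (0 : R) < n.+1%:R^-1 by rewrite invr_gt0 ltr0n.
  have ne : n.+1%:R^-1 + n.+1%:R^-1 < e.
    have : 2 / e < n.+1%:R by rewrite truncnS_gt.
    rewrite ltr_pdivrMr// => h.
    rewrite (_ : _ + _ = 2 / n.+1%:R); last by rewrite mulr_natl mulr2n.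
    by rewrite ltr_pdivrMr ?ltr0n// mulrC.
  have H i : {q : rat | ball (x ord0 i) n.+1%:R^-1 (ratr q : R)}.
    apply: cid.
    have ne0 : ball (x ord0 i : R) n.+1%:R^-1 !=set0.
      by exists (x ord0 i); exact: ballxx.
    have [|y [By [q _ qy]]] := @dense_rat R _ ne0; first exact: ball_open.
    by exists q; rewrite qy.
  exists (\row_i sval (H i), n) => //.
  have Bx : B (\row_i sval (H i), n) x.
    by move=> i /=; rewrite mxE; apply: ball_sym; exact: (svalP (H i)).
  rewrite /F; case: asboolP => // -[] y By; apply: eU; split => // k j.
  rewrite (ord1 k); apply: le_ball (ltW ne) _ _.
  apply: ball_triangle (ball_sym _) (By j).
  exact: Bx.
apply: (@countable_bigcupT_measurable _ _ _ F); first exact: countableP.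
move=> p; rewrite /F; case: asboolP => // _.
apply: (@measurable_rV_box (fun i => ball (ratr (p.1 ord0 i) : R) p.2.+1%:R^-1)).
by move=> i; exact: measurable_ball.
Qed.

Lemma closed_measurable_rV U : closed U -> measurable U.
Proof.
move=> cU; rewrite -(setCK U); apply: measurableC; apply: open_measurable_rV.
exact: closed_openC.
Qed.

Lemma continuous_measurable_rV (h : 'rV[R]_d -> R^o) (D : set 'rV[R]_d) :
  continuous h -> measurable_fun D (h : 'rV[R]_d -> R).
Proof.
move=> /continuousP ch; apply: (@measurable_funS _ _ _ _ setT) => //.
apply: (measurability _ (RGenOpens.measurableE R)) => _ [_ [a [b ->] <-]].
rewrite setTI; apply: open_measurable_rV; apply: ch; exact: interval_open.
Qed.

End rV_borel.

(** * Finite measure of bounded sets and measurability of the perforated domain *)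

Lemma leb_cube_lty {R : realType} (d : nat) (r : R) :
  (@leb R d [set x : 'rV[R]_d | forall i, `[(- r)%R, r]%classic (x ord0 i)] < +oo)%E.
Proof.
elim: d => [|d IH].
  by apply: (@le_lt_trans _ _ 1%E); rewrite ?ltry//= diracE;
    case: (_ \in _); rewrite ?lexx ?lee_fin.
rewrite /= /lebesgue_rV_step /pushforward.
(* Pulled back by [rV_cons], the cube splits into an interval and a cube of one dimension less, to
   which the induction hypothesis applies. *)
rewrite [X in (lebesgue_measure \x _)%E X](_ : _ =
    `[- r, r]%classic `*`
    [set x : 'rV[R]_d | forall i, `[- r, r]%classic (x ord0 i)]); last first.
  apply/seteqP; split => -[a x] /=.
    move=> h; split; first by have := h ord0; rewrite mxE unlift_none.
    by move=> i; have := h (lift ord0 i); rewrite mxE liftK.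
  move=> [ha hx] i; rewrite mxE; case: (unliftP ord0 i) => [j _|_] //=.
rewrite product_measure1E//; last first.
  by apply: (@measurable_rV_box _ _ (fun=> `[- r, r]%classic)) => i; exact: measurable_itv.
apply: lte_mul_pinfty => //.
rewrite ge0_fin_numE//= lebesgue_measure_itv/=.
by case: ifP => _; rewrite -?EFinD ltry.
Qed.

Section perforated_measure.
Context {R : realType} {d : nat}.
Implicit Types (O Omega T : set 'rV[R]_d).

Lemma rV_entry_le_norm (x : 'rV[R]_d) i : `|x ord0 i| <= `|x|.
Proof.
by rewrite /Num.Def.normr/= mx_normrE (le_bigmax _ _ (ord0, i)).
Qed.

Lemma bounded_set_norm_le O : bounded_set O -> exists r : R, forall x, O x -> `|x| <= r.
Proof.
case=> M [_ /(_ (M + 1))]; rewrite ltrDl ltr01 => /(_ isT) h.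
by exists (M + 1) => x; exact: h.
Qed.

Lemma bounded_leb_lty O : bounded_set O -> measurable O -> (@leb R d O < +oo)%E.
Proof.
move=> bO mO; have [r Or] := bounded_set_norm_le bO.
apply: le_lt_trans (leb_cube_lty d r); apply: le_measure; rewrite ?inE//.
  by apply: (@measurable_rV_box _ _ (fun=> `[- r, r]%classic)) => i; exact: measurable_itv.
by move=> x /Or xr i /=; rewrite in_itv/= -ler_norml (le_trans (rV_entry_le_norm x i)).
Qed.

(** Cells are indexed by integer vectors, so countably many holes are removed, each of them the
    continuous image of a compact set. *)
Lemma measurable_perforated Omega T (eps : R) (K : set 'rV[int]_d) :
  open Omega -> compact T -> measurable (perforated eps K Omega T).
Proof.
move=> oO cT; apply: measurableD; first exact: open_measurable_rV.
rewrite bigcup_mkcond; apply: countable_bigcupT_measurable => [|k]; first exact: countableP.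
case: ifP => // _; apply: closed_measurable_rV; apply: compact_closed.
  exact: norm_hausdorff.
apply: continuous_compact => //; apply: continuous_subspaceT => y.
apply: (@cvgZl_tmp R 'rV[R]_d _ _ (@nbhs_filter _ y)).
by apply: (@cvgD R 'rV[R]_d); [exact: cvg_cst|exact: cvg_id].
Qed.

End perforated_measure.

(** * Square-integrable functions and their inner product *)

Section L2_algebra.
Context {R : realType} {d : nat}.
Variable O : set 'rV[R]_d.
Hypothesis mO : measurable O.
Implicit Types (u v w h : 'rV[R]_d -> R) (g : 'rV[R]_d -> 'rV[R]_d).

Local Notation mu := (@leb R d).
Local Notation integ h := (mu.-integrable O (EFin \o h)).

Lemma le_integrable_EFin w h : measurable_fun O w -> integ h ->
  (forall x, O x -> `|w x| <= h x) -> integ w.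
Proof.
move=> mw ih wh; apply: le_integrable ih => //; first exact/measurable_EFinP.
by move=> x Ox /=; rewrite lee_fin (le_trans (wh x Ox))// ler_norm.
Qed.

Lemma integrableD_EFin u v : integ u -> integ v -> integ (fun x => u x + v x).
Proof. by move=> iu iv; exact: (integrableD mO iu iv). Qed.

Lemma integrableZ_EFin (c : R) u : integ u -> integ (fun x => c * u x).
Proof. by move=> iu; exact: (integrableZl mO c iu). Qed.

Lemma integrable_sum_EFin (I : Type) (r : seq I) (h : I -> 'rV[R]_d -> R) :
  (forall i, integ (h i)) -> integ (fun x => \sum_(i <- r) h i x).
Proof.
move=> ih.
have -> : EFin \o (fun x => \sum_(i <- r) h i x) =
    (fun x => \sum_(i <- r) (EFin \o h i) x)%E.
  by apply/funext => x /=; rewrite sumEFin.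
by apply: integrable_sum => // i _; exact: ih.
Qed.

Lemma L2_dominated w h : measurable_fun O w -> integ h ->
  (forall x, O x -> w x ^+ 2 <= h x) -> L2 O w.
Proof.
move=> mw ih wh; split => //; apply: (le_integrable_EFin (h := h)) => //.
  exact: measurable_funX.
by move=> x Ox; rewrite ger0_norm ?sqr_ge0 ?wh.
Qed.

Lemma L2_sqr_integrable u : L2 O u -> integ (fun x => u x ^+ 2).
Proof. by case. Qed.

Lemma L2M_integrable u v : L2 O u -> L2 O v -> integ (fun x => u x * v x).
Proof.
move=> [mu_ iu] [mv iv]; apply: (le_integrable_EFin (h := fun x => u x ^+ 2 + v x ^+ 2)).
- exact: measurable_funM.
- exact: integrableD_EFin.
- move=> x _; rewrite normrM -(real_normK (num_real (u x))) -(real_normK (num_real (v x))).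
  by have := normr_ge0 (u x); have := normr_ge0 (v x); nra.
Qed.

Lemma L2D u v : L2 O u -> L2 O v -> L2 O (fun x => u x + v x).
Proof.
move=> [mu_ iu] [mv iv].
apply: (L2_dominated (h := fun x => 2 * (u x ^+ 2 + v x ^+ 2))).
- exact: measurable_funD.
- by apply: integrableZ_EFin; exact: integrableD_EFin.
(* [2 * (u ^ 2 + v ^ 2) - (u + v) ^ 2] is the square of [u - v]. *)
- by move=> x _; have := sqr_ge0 (u x - v x); nra.
Qed.

Lemma L2Z (c : R) u : L2 O u -> L2 O (fun x => c * u x).
Proof.
move=> [mu_ iu]; apply: (L2_dominated (h := fun x => c ^+ 2 * u x ^+ 2)).
- by apply: measurable_funM.
- exact: integrableZ_EFin.
- by move=> x _; rewrite exprMn.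
Qed.

Lemma L2B u v : L2 O u -> L2 O v -> L2 O (fun x => u x - v x).
Proof.
move=> hu hv; rewrite (_ : (fun x => _) = (fun x => u x + (-1) * v x)).
  by apply: L2D => //; exact: L2Z.
by apply/funext => x; rewrite mulN1r.
Qed.

Lemma L2_normr u : L2 O u -> L2 O (fun x => `|u x|).
Proof.
move=> [mu_ iu]; apply: (L2_dominated (h := fun x => u x ^+ 2)) => //.
  exact: measurableT_comp.
by move=> x _; rewrite real_normK ?num_real.
Qed.

Lemma L2norm_ge0 u : 0 <= L2norm O u. Proof. exact: sqrtr_ge0. Qed.

Lemma sqr_L2norm u : L2norm O u ^+ 2 = L2prod O u u.
Proof.
rewrite sqr_sqrtr; last by apply: Rintegral_ge0 => x _; exact: sqr_ge0.
by apply: eq_Rintegral => x _; rewrite expr2.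
Qed.

Lemma L2prod_ge0 u : 0 <= L2prod O u u.
Proof. by apply: Rintegral_ge0 => x _; rewrite -expr2 sqr_ge0. Qed.

Lemma L2prodDl u v w : L2 O u -> L2 O v -> L2 O w ->
  L2prod O (fun x => u x + v x) w = L2prod O u w + L2prod O v w.
Proof.
move=> hu hv hw; rewrite /L2prod -RintegralD//; [|exact: L2M_integrable..].
by apply: eq_Rintegral => x _; rewrite mulrDl.
Qed.

Lemma L2prodZl (c : R) u w : L2 O u -> L2 O w ->
  L2prod O (fun x => c * u x) w = c * L2prod O u w.
Proof.
move=> hu hw; rewrite /L2prod -RintegralZl//; last exact: L2M_integrable.
by apply: eq_Rintegral => x _; rewrite mulrA.
Qed.

Lemma L2prodBl u v w : L2 O u -> L2 O v -> L2 O w ->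
  L2prod O (fun x => u x - v x) w = L2prod O u w - L2prod O v w.
Proof.
move=> hu hv hw; rewrite /L2prod -RintegralB//; [|exact: L2M_integrable..].
by apply: eq_Rintegral => x _; rewrite mulrBl.
Qed.

Lemma L2prodC u v : L2prod O u v = L2prod O v u.
Proof. by apply: eq_Rintegral => x _; rewrite mulrC. Qed.

Lemma le_L2prod u v u' v' : L2 O u -> L2 O v -> L2 O u' -> L2 O v' ->
  (forall x, O x -> u x * v x <= u' x * v' x) -> L2prod O u v <= L2prod O u' v'.
Proof.
by move=> hu hv hu' hv' h; apply: le_Rintegral => //; exact: L2M_integrable.
Qed.

(** The Cauchy-Schwarz inequality, from the nonnegativity of the squared norm of [s * u - t * v] for
    well-chosen [s] and [t]. *)
Lemma L2prod_le_norm u v : L2 O u -> L2 O v ->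
  L2prod O u v <= L2norm O u * L2norm O v.
Proof.
move=> hu hv.
have := L2norm_ge0 u; have := L2norm_ge0 v.
have := sqr_L2norm u; have := sqr_L2norm v.
set a := L2norm O u; set b := L2norm O v => Eb Ea b0 a0.
have K (s t : R) : 2 * (s * t) * L2prod O u v <= s ^+ 2 * a ^+ 2 + t ^+ 2 * b ^+ 2.
  have /= := L2prod_ge0 (fun x => s * u x - t * v x).
  rewrite L2prodBl; [|exact: L2Z|exact: L2Z|by apply: L2B; exact: L2Z].
  rewrite !L2prodZl//; [|by apply: L2B; exact: L2Z..].
  rewrite ![L2prod O _ (fun x => _ - _)]L2prodC.
  rewrite !L2prodBl//; [|exact: L2Z..].
  rewrite !L2prodZl// (L2prodC v u) -Ea -Eb.
  lra.
(* K b a is the optimal choice when both norms are positive; if one of them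
   vanishes, its parameter is taken large instead. *)
have [b00|bn0] := eqVneq b 0.
  rewrite b00 mulr0 leNgt; apply/negP => P0.
  have := K 1 ((a ^+ 2 + 1) / L2prod O u v).
  have := divfK (lt0r_neq0 P0) (a ^+ 2 + 1).
  by rewrite b00; set t := _ / _ => E; nra.
have [a00|an0] := eqVneq a 0.
  rewrite a00 mul0r leNgt; apply/negP => P0.
  have := K ((b ^+ 2 + 1) / L2prod O u v) 1.
  have := divfK (lt0r_neq0 P0) (b ^+ 2 + 1).
  by rewrite a00; set t := _ / _ => E; nra.
have := K b a.
have : 0 < a * b by rewrite mulr_gt0// lt_def ?an0 ?bn0.
nra.
Qed.

End L2_algebra.

(** * Stability of [H1_0] under subtraction on a bounded set *)

Section sobolev_subtraction.
Context {R : realType} {d : nat}.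
Variable O : set 'rV[R]_d.
Hypotheses (mO : measurable O) (bO : bounded_set O).
Implicit Types (u v w phi psi : 'rV[R]_d -> R) (g h : 'rV[R]_d -> 'rV[R]_d).

Local Notation mu := (@leb R d).
Local Notation integ h := (mu.-integrable O (EFin \o h)).

(** [O] need not be closed, but it sits in a compact cube on which the globally continuous [phi] is
    bounded. *)
Lemma continuous_bounded_on phi : continuous (phi : 'rV[R]_d -> R^o) ->
  exists C : R, forall x, O x -> `|phi x| <= C.
Proof.
move=> cphi; have [r Or] := bounded_set_norm_le bO.
have cB : compact [set x : 'rV[R]_d | forall i, `[- r, r]%classic (x ord0 i)].
  by apply: (@rV_compact _ _ (fun=> `[- r, r]%classic)) => i; exact: segment_compact.
have /compact_bounded[M [_ /(_ (M + 1))]] :=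
  continuous_compact (continuous_subspaceT cphi) cB.
rewrite ltrDl ltr01 => /(_ isT) h; exists (M + 1) => x Ox; apply: h; exists x => //.
move=> i /=; rewrite in_itv/= -ler_norml.
by rewrite (le_trans (rV_entry_le_norm x i))// Or.
Qed.

Lemma L2_cst (c : R) : L2 O (fun=> c).
Proof.
apply: (L2_dominated mO (h := fun=> c ^+ 2)) => //.
apply: measurable_bounded_integrable => //; first exact: bounded_leb_lty.
by exists `|c ^+ 2|; split => // y /ltW + x _.
Qed.

Lemma sqr_le_sqr (a c : R) : `|a| <= c -> a ^+ 2 <= c ^+ 2.
Proof. by rewrite ler_norml => ?; nra. Qed.

Lemma continuous_L2 phi : continuous (phi : 'rV[R]_d -> R^o) -> L2 O phi.
Proof.
move=> cphi; have [C hC] := continuous_bounded_on cphi.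
apply: (L2_dominated mO (h := fun=> C ^+ 2)).
- exact: continuous_measurable_rV.
- exact/L2_sqr_integrable/L2_cst.
- by move=> x /hC; exact: sqr_le_sqr.
Qed.

Lemma bounded_mul_L2 (a u : 'rV[R]_d -> R) (C : R) : measurable_fun O a ->
  (forall x, O x -> `|a x| <= C) -> L2 O u -> L2 O (fun x => a x * u x).
Proof.
move=> ma aC [mu_ iu]; apply: (L2_dominated mO (h := fun x => C ^+ 2 * u x ^+ 2)).
- exact: measurable_funM.
- exact: integrableZ_EFin.
- move=> x Ox; rewrite exprMn ler_wpM2r ?sqr_ge0//.
  by apply: sqr_le_sqr; exact: aC.
Qed.

Lemma smooth_continuous phi : smooth phi -> continuous (phi : 'rV[R]_d -> R^o).
Proof. by move=> /(_ [::])[]. Qed.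

Lemma smooth_partial_continuous phi i :
  smooth phi -> continuous (partial i phi : 'rV[R]_d -> R^o).
Proof. by move=> /(_ [:: i])[]. Qed.

Lemma smooth_grad_L2 phi : smooth phi -> L2vec O (grad phi).
Proof.
move=> sphi i; rewrite (_ : (fun x => _) = partial i phi).
  by apply: continuous_L2; exact: smooth_partial_continuous.
by apply/funext => x; rewrite mxE.
Qed.

Lemma partialB i phi psi :
  (forall x, derivable (phi : 'rV[R]_d -> R^o) x (delta_mx ord0 i)) ->
  (forall x, derivable (psi : 'rV[R]_d -> R^o) x (delta_mx ord0 i)) ->
  partial i (fun x => phi x - psi x) = fun x => partial i phi x - partial i psi x.
Proof. by move=> dphi dpsi; apply/funext => x; exact: deriveB. Qed.

(** Smoothness speaks of all iterated partial derivatives, so additivity is needed at every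
    order. *)
Lemma iter_partialB s phi psi : smooth phi -> smooth psi ->
  iter_partial s (fun x => phi x - psi x) =
  fun x => iter_partial s phi x - iter_partial s psi x.
Proof.
move=> sphi spsi; elim: s => //= i s ->; apply: partialB => x.
- by have [_] := sphi s; exact.
- by have [_] := spsi s; exact.
Qed.

Lemma smoothB phi psi : smooth phi -> smooth psi ->
  smooth (fun x => phi x - psi x).
Proof.
move=> sphi spsi s; rewrite iter_partialB//.
have [c1 d1] := sphi s; have [c2 d2] := spsi s; split.
- by move=> x; exact: (cvgB (c1 x) (c2 x)).
- by move=> i x; apply: derivableB; [exact: d1|exact: d2].
Qed.

Lemma gradB phi psi : smooth phi -> smooth psi ->
  grad (fun x => phi x - psi x) = fun x => grad phi x - grad psi x.
Proof.
move=> sphi spsi; apply/funext => x; apply/rowP => i; rewrite !mxE.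
by rewrite -[partial i _]/(iter_partial [:: i] _) iter_partialB.
Qed.

Lemma L2vecB g h : L2vec O g -> L2vec O h -> L2vec O (fun x => g x - h x).
Proof.
move=> hg hh i; rewrite (_ : (fun x => _) = fun x => g x ord0 i - h x ord0 i).
  exact: L2B.
by apply/funext => x; rewrite !mxE.
Qed.

Lemma dotp_integrable g h : L2vec O g -> L2vec O h ->
  integ (fun x => dotp (g x) (h x)).
Proof.
by move=> hg hh; apply: integrable_sum_EFin => // i; exact: L2M_integrable.
Qed.

Lemma dotp_ge0 (x : 'rV[R]_d) : 0 <= dotp x x.
Proof. by apply: sumr_ge0 => i _; rewrite -expr2 sqr_ge0. Qed.

Lemma sqr_L2norm_vec g : L2norm_vec O g ^+ 2 = \int[mu]_(x in O) dotp (g x) (g x).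
Proof. by rewrite sqr_sqrtr//; apply: Rintegral_ge0 => x _; exact: dotp_ge0. Qed.

(** Splitting the integrals requires integrable products; a test function and its partial
    derivatives are continuous, hence in [L2] on the bounded set [O]. *)
Lemma weak_gradientB u v g h : L2 O u -> L2 O v -> L2vec O g -> L2vec O h ->
  weak_gradient O u g -> weak_gradient O v h ->
  weak_gradient O (fun x => u x - v x) (fun x => g x - h x).
Proof.
move=> hu hv hg hh wu wv phi tphi i.
have Lphi := continuous_L2 (smooth_continuous tphi.1).
have Ldphi : L2 O (partial i phi).
  by apply: continuous_L2; exact: smooth_partial_continuous tphi.1.
have -> : \int[mu]_(x in O) ((g x - h x) ord0 i * phi x) =
    L2prod O (fun x => g x ord0 i - h x ord0 i) phi.
  by apply: eq_Rintegral => x _; rewrite !mxE.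
have -> := L2prodBl mO (hg i) (hh i) Lphi; rewrite -/(L2prod O _ _).
have -> := L2prodBl mO hu hv Ldphi.
by rewrite /L2prod wu// wv//; ring.
Qed.

(* The factor 2 spares Minkowski's inequality; it is harmless where the norms
   are only required to be small. *)
Lemma sqrt_Rintegral_le (F G H : 'rV[R]_d -> R) :
  integ F -> integ G -> integ H -> (forall x, O x -> 0 <= G x) ->
  (forall x, O x -> 0 <= H x) ->
  (forall x, O x -> F x <= 2 * (G x + H x)) ->
  Num.sqrt (\int[mu]_(x in O) F x) <=
  2 * (Num.sqrt (\int[mu]_(x in O) G x) + Num.sqrt (\int[mu]_(x in O) H x)).
Proof.
move=> iF iG iH G0 H0 FGH.
have IG0 : 0 <= \int[mu]_(x in O) G x by exact: Rintegral_ge0.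
have IH0 : 0 <= \int[mu]_(x in O) H x by exact: Rintegral_ge0.
have : \int[mu]_(x in O) F x <= 2 * (\int[mu]_(x in O) G x + \int[mu]_(x in O) H x).
  rewrite -RintegralD// -RintegralZl//; last exact: integrableD_EFin.
  by apply: le_Rintegral => //; apply: integrableZ_EFin => //; exact: integrableD_EFin.
move: (sqr_sqrtr IG0) (sqr_sqrtr IH0) (sqrtr_ge0 (\int[mu]_(x in O) G x))
  (sqrtr_ge0 (\int[mu]_(x in O) H x)).
set a := Num.sqrt (\int[mu]_(x in O) G x); set b := Num.sqrt _.
move=> <- <- a0 b0 Fab.
rewrite -(@ger0_norm _ (2 * (a + b))) ?mulr_ge0 ?addr_ge0//.
rewrite -sqrtr_sqr ler_wsqrtr// (le_trans Fab)//.
nra.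
Qed.

Lemma L2norm_quasi_triangle u v phi psi :
  L2 O u -> L2 O v -> L2 O phi -> L2 O psi ->
  L2norm O (fun x => u x - v x - (phi x - psi x)) <=
  2 * (L2norm O (fun x => u x - phi x) + L2norm O (fun x => v x - psi x)).
Proof.
move=> hu hv hphi hpsi; apply: sqrt_Rintegral_le.
- by apply/L2_sqr_integrable/L2B => //; exact: L2B.
- exact/L2_sqr_integrable/L2B.
- exact/L2_sqr_integrable/L2B.
- by move=> x _; exact: sqr_ge0.
- by move=> x _; exact: sqr_ge0.
- by move=> x _; have := sqr_ge0 ((u x - phi x) + (v x - psi x)); nra.
Qed.

Lemma L2norm_vec_quasi_triangle g h g' h' :
  L2vec O g -> L2vec O h -> L2vec O g' -> L2vec O h' ->
  L2norm_vec O (fun x => g x - h x - (g' x - h' x)) <=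
  2 * (L2norm_vec O (fun x => g x - g' x) + L2norm_vec O (fun x => h x - h' x)).
Proof.
move=> hg hh hg' hh'; apply: sqrt_Rintegral_le.
- by apply: dotp_integrable; apply: L2vecB; exact: L2vecB.
- by apply: dotp_integrable; exact: L2vecB.
- by apply: dotp_integrable; exact: L2vecB.
- by move=> x _; exact: dotp_ge0.
- by move=> x _; exact: dotp_ge0.
- move=> x _; rewrite /dotp -big_split/= mulr_sumr; apply: ler_sum => i _.
  rewrite !mxE; have := sqr_ge0 ((g x ord0 i - g' x ord0 i) + (h x ord0 i - h' x ord0 i)).
  nra.
Qed.

Lemma sum_lt_of_quarters (e a b a' b' s t : R) : a + b < e / 4 -> a' + b' < e / 4 ->
  s <= 2 * (a + a') -> t <= 2 * (b + b') -> s + t < e.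
Proof. lra. Qed.

Lemma zero_onB Gam u v g h : L2 O u -> L2 O v -> L2vec O g -> L2vec O h ->
  zero_on O Gam u g -> zero_on O Gam v h ->
  zero_on O Gam (fun x => u x - v x) (fun x => g x - h x).
Proof.
move=> hu hv hg hh zu zv e e0.
(* A quarter for each approximation: two of them, times the factor 2 of the quasi-triangle
   inequalities, give [e]. *)
have e40 : 0 < e / 4 by rewrite divr_gt0.
have [phi [sphi [U [oU GU U0]] hphi]] := zu _ e40.
have [psi [spsi [V [oV GV V0]] hpsi]] := zv _ e40.
exists (fun x => phi x - psi x); split.
- exact: smoothB.
- exists (U `&` V); split; [exact: openI|by move=> x Gx; split; [exact: GU|exact: GV]|].
  by move=> x [Ux Vx]; rewrite U0// V0// subr0.
- rewrite gradB//.
  have K1 := L2norm_quasi_triangle hu hv (continuous_L2 (smooth_continuous sphi))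
    (continuous_L2 (smooth_continuous spsi)).
  have K2 := L2norm_vec_quasi_triangle hg hh (smooth_grad_L2 sphi) (smooth_grad_L2 spsi).
  exact: sum_lt_of_quarters hphi hpsi K1 K2.
Qed.

(** This makes the error between solution and iterate an admissible test function, and lets
    Poincare's inequality apply to it. *)
Lemma H1_0B Gam u v g h : H1_0 O Gam u g -> H1_0 O Gam v h ->
  H1_0 O Gam (fun x => u x - v x) (fun x => g x - h x).
Proof.
move=> [[hu hg wu] zu] [[hv hh wv] zv]; split; last exact: zero_onB.
by split; [exact: L2B|exact: L2vecB|exact: weak_gradientB].
Qed.

End sobolev_subtraction.

(** * Nonlinearities with slopes between 0 and [delta] *)

Section slopes.
Context {R : realType}.
Implicit Types (S : R -> R) (delta : R).

(* "0 <= S' <= delta" in integrated form, which passes to uniform limits. *)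
Definition slopes_in delta S : Prop :=
  forall x y, x <= y -> 0 <= S y - S x <= delta * (y - x).

(** The mean value theorem turns the pointwise bounds on the derivative into bounds on
    increments. *)
Lemma regularization_slopes F (delta0 delta1 sigma C gamma : R) S :
  regularization F delta0 delta1 sigma C gamma S -> slopes_in delta1 S.
Proof.
move=> [dS _] x y xy.
have dS1 z : z \in `]x, y[ -> is_derive z 1 S (derive1 (S : R -> R^o) z).
  by move=> _; rewrite derive1E; apply/derivableP; have [] := dS z.
have cS : {within `[x, y], continuous S}.
  by apply: derivable_within_continuous => z _; have [] := dS z.
have [c _ ->] := MVT_segment xy dS1 cS.
have [_ [/andP[p0 pS] S1]] := dS c.
rewrite mulr_ge0 ?subr_ge0 ?(ltW (lt_le_trans p0 pS))//=.
by rewrite ler_wpM2r ?subr_ge0.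
Qed.

Lemma le_limit_geometric (a b c omega : R) : 0 <= c -> 0 < omega < 1 ->
  (forall k, (1 <= k)%N -> a <= b + c * omega ^+ k) -> a <= b.
Proof.
move=> c0 /andP[w0 w1] abc; apply/ler_addgt0Pr => e e0.
(* [c + 1] replaces [c] to allow division when [c = 0]; the index [N.+1] is used because the bound
   is assumed only from 1 on. *)
have w1' : `|omega| < 1 by rewrite gtr0_norm.
have /cvgrPdist_lt/(_ (e / (c + 1))) := cvg_expr w1'.
rewrite divr_gt0// ?ltr_wpDl// => /(_ isT) [N _ /(_ N.+1 (leqnSn N))].
rewrite /= sub0r normrN normrX gtr0_norm// ltr_pdivlMr ?ltr_wpDl// => oN.
apply: le_trans (abc N.+1 isT) _; rewrite lerD2l.
apply: le_trans (ltW oN).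
by rewrite mulrC ler_wpM2l ?exprn_ge0 ?ltW// ltrDl.
Qed.

(** An increment of [F] differs from that of [Fk k] by one error at each endpoint, hence the
    constant [c + c] in the limit argument. *)
Lemma slopes_in_limit F (Fk : nat -> R -> R) (c delta omega : R) :
  0 <= c -> 0 < omega < 1 ->
  (forall k, (1 <= k)%N -> slopes_in delta (Fk k)) ->
  (forall k, (1 <= k)%N -> forall x, `|F x - Fk k x| <= c * omega ^+ k) ->
  slopes_in delta F.
Proof.
move=> c0 w01 sF dF x y xy; have c20 : 0 <= c + c by exact: addr_ge0.
apply/andP; split; apply: (le_limit_geometric c20 w01) => k k1.
  have /andP[] := sF k k1 x y xy.
  have := dF k k1 x; have := dF k k1 y; rewrite !ler_norml mulrDl.
  by clear; lra.
have /andP[] := sF k k1 x y xy.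
have := dF k k1 x; have := dF k k1 y; rewrite !ler_norml mulrDl.
by clear; lra.
Qed.

Lemma slopes_in_measurable delta S : slopes_in delta S -> measurable_fun setT S.
Proof.
move=> sS; apply: nondecreasing_measurable => // x y /sS/andP[].
by rewrite subr_ge0.
Qed.

Lemma slopes_in_growth delta S x : slopes_in delta S ->
  `|S x| <= delta * `|x| + `|S 0|.
Proof.
move=> sS; have := lexx `|S 0|; rewrite {1}ler_norml.
case: (lerP 0 x) => [|/ltW] x0; have /andP[] := sS _ _ x0.
  rewrite ler_norml (ger0_norm x0) subr0.
  by move: (S x) (S 0) (delta * _) => a b c; clear; lra.
rewrite ler_norml (ler0_norm x0) sub0r.
by move: (S x) (S 0) (delta * _) => a b c; clear; lra.
Qed.

(** Monotonicity gives [(S x - S 0) * x >= 0]; this bounds the reaction term from below in the a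
    priori estimate. *)
Lemma slopes_in_monotone delta S x : slopes_in delta S -> - `|S 0| * `|x| <= S x * x.
Proof.
move=> sS; have := lexx `|S 0|; rewrite {1}ler_norml.
case: (lerP 0 x) => [|/ltW] x0; have /andP[+ _] := sS _ _ x0.
  rewrite (ger0_norm x0).
  by move: (S x) (S 0) => a b; move: `|b| => c; clear -x0; nra.
rewrite (ler0_norm x0).
by move: (S x) (S 0) => a b; move: `|b| => c; clear -x0; nra.
Qed.

(* This is why M = eta + eps^alpha delta1 stabilises the linearisation: all
   slopes of s |-> M s - eps^alpha S s lie in [eta, M]. *)
Lemma slopes_in_contraction delta S (eta t x y : R) : 0 <= eta -> 0 <= t ->
  slopes_in delta S ->
  `|(eta + t * delta) * (x - y) - t * (S x - S y)| <= (eta + t * delta) * `|x - y|.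
Proof.
move=> eta0 t0 sS; wlog xy : x y / y <= x.
  move=> H; case: (leP y x) => [|/ltW] xy; first exact: H.
  rewrite (_ : _ - _ = - ((eta + t * delta) * (y - x) - t * (S y - S x))); last by ring.
  by rewrite normrN (distrC x); exact: H.
have /andP[S0 S1] := sS _ _ xy.
rewrite (ger0_norm (x := x - y)) ?subr_ge0// ler_norml.
have h1 : 0 <= t * (S x - S y) by exact: mulr_ge0.
have h2 : t * (S x - S y) <= t * (delta * (x - y)) by exact: ler_wpM2l.
have h3 : 0 <= eta * (x - y) by rewrite mulr_ge0// subr_ge0.
move: h1 h2 h3; rewrite mulrDl -mulrA.
by move: (t * (S x - S y)) (eta * _) (t * (delta * _)) => a b c; clear; lra.
Qed.

End slopes.

Lemma powR_le1 {R : realType} (eps alpha : R) : 0 < eps < 1 -> 0 <= alpha ->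
  eps `^ alpha <= 1.
Proof.
move=> /andP[e0 e1] a0; have -> : 1 = 1 `^ alpha :> R by rewrite powR1.
by apply: ge0_ler_powR; rewrite ?nnegrE ?(ltW e0) ?(ltW e1).
Qed.

(** * The diffusion form and the energy estimates *)

Section diffusion.
Context {R : realType} {d : nat}.
Variables (O : set 'rV[R]_d) (A : 'rV[R]_d -> 'M[R]_d) (eps glo ghi : R).
Hypotheses (mO : measurable O) (bO : bounded_set O) (eps01 : 0 < eps < 1).
Hypothesis hA : admissible_coefficient A glo ghi.
Implicit Types (u v : 'rV[R]_d -> R) (g h : 'rV[R]_d -> 'rV[R]_d).

Local Notation mu := (@leb R d).

(** An entry is bounded by the matrix norm, so it inherits the Lipschitz bound. Continuity then
    yields measurability and boundedness on [O], which make the diffusion form integrable. *)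
Lemma scaled_entry_continuous i j :
  continuous ((fun x => A (eps^-1 *: x) i j) : 'rV[R]_d -> R^o).
Proof.
have [_ _ _ [L [_ hL]] _] := hA.
(* The Lipschitz property holds for every constant above [L]; this one is also positive. *)
have /hL lipA : L < `|L| + 1 by rewrite (le_lt_trans (ler_norm L)) ?ltrDl.
move=> x.
have Fx : Filter (nbhs x) by exact: nbhs_filter.
apply/cvgrPdist_lt => e e0.
have c0 : 0 < (`|L| + 1) * `|eps^-1| + 1 by rewrite ltr_wpDl// mulr_ge0// addr_ge0.
near=> y.
have /= Axy := lipA (eps^-1 *: x, eps^-1 *: y) (conj Logic.I Logic.I).
rewrite (_ : A (eps^-1 *: x) i j - A (eps^-1 *: y) i j =
  (A (eps^-1 *: x) - A (eps^-1 *: y)) i j); last by rewrite !mxE.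
apply: le_lt_trans (_ : `|A (eps^-1 *: x) - A (eps^-1 *: y)| < e).
  by rewrite [X in _ <= X]/Num.Def.normr/= mx_normrE (le_bigmax _ _ (i, j)).
apply: le_lt_trans Axy _; rewrite -scalerBr normrZ mulrA.
apply: (@le_lt_trans _ _ (((`|L| + 1) * `|eps^-1| + 1) * `|x - y|)).
  by rewrite ler_wpM2r// lerDl.
rewrite mulrC -ltr_pdivlMr//; near: y.
by apply: cvgr_dist_lt; rewrite ?divr_gt0//; exact: cvg_id.
Unshelve. all: by end_near. Qed.

Lemma scaled_entryM_L2 i j u : L2 O u -> L2 O (fun x => A (eps^-1 *: x) i j * u x).
Proof.
have cA : continuous ((fun x => A (eps^-1 *: x) i j) : 'rV[R]_d -> R^o).
  exact: scaled_entry_continuous.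
have [C hC] := continuous_bounded_on bO cA.
by apply: (bounded_mul_L2 mO _ hC); exact: continuous_measurable_rV.
Qed.

Lemma diffusion_integrable g h : L2vec O g -> L2vec O h ->
  mu.-integrable O (EFin \o (fun x =>
    \sum_i \sum_j A (eps^-1 *: x) i j * g x ord0 j * h x ord0 i)).
Proof.
move=> hg hh; apply: integrable_sum_EFin => // i.
apply: integrable_sum_EFin => // j.
by apply: L2M_integrable => //; exact: scaled_entryM_L2.
Qed.

Lemma diffusion_formBl g g' h : L2vec O g -> L2vec O g' -> L2vec O h ->
  diffusion_form A eps O (fun x => g x - g' x) h =
  diffusion_form A eps O g h - diffusion_form A eps O g' h.
Proof.
move=> hg hg' hh.
rewrite /diffusion_form -RintegralB//; [|exact: diffusion_integrable..].
apply: eq_Rintegral => x _; rewrite -sumrB; apply: eq_bigr => i _.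
rewrite -sumrB; apply: eq_bigr => j _; rewrite !mxE; ring.
Qed.

Lemma diffusion_coercive g : L2vec O g ->
  glo * L2norm_vec O g ^+ 2 <= diffusion_form A eps O g g.
Proof.
move=> hg; rewrite sqr_L2norm_vec -RintegralZl//; last exact: dotp_integrable.
apply: le_Rintegral => //.
- by apply: integrableZ_EFin => //; exact: dotp_integrable.
- exact: diffusion_integrable.
- move=> x _; have [_ _ _ _ [_ _ /(_ _ eps01 x (g x))[+ _]]] := hA.
  move=> /le_trans; apply; apply: ler_sum => i _; apply: ler_sum => j _.
  by rewrite mulrAC.
Qed.

(** Linear growth suffices because constants are square integrable on the bounded set [O]. *)
Lemma L2_slopes (delta : R) (S : R -> R) u : slopes_in delta S -> L2 O u -> L2 O (S \o u).
Proof.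
move=> sS [mu_ iu].
have hg := L2D mO (L2Z mO delta (L2_normr mO (conj mu_ iu))) (L2_cst mO bO `|S 0|).
apply: (L2_dominated mO _ (L2_sqr_integrable hg)).
  by apply: measurableT_comp => //; exact: slopes_in_measurable sS.
by move=> x _; apply: sqr_le_sqr; exact: slopes_in_growth.
Qed.

Lemma L2norm_normr u : L2norm O (fun x => `|u x|) = L2norm O u.
Proof.
by congr Num.sqrt; apply: eq_Rintegral => x _; rewrite real_normK ?num_real.
Qed.

Lemma L2prod_affine_bound w p v (m c : R) : 0 <= m -> 0 <= c ->
  L2 O w -> L2 O p -> L2 O v -> (forall x, O x -> `|w x| <= m * `|p x| + c) ->
  L2prod O w v <= (m * L2norm O p + c * L2norm O (fun=> 1)) * L2norm O v.
Proof.
move=> m0 c0 hw hp hv wpc.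
have hp' := L2_normr mO hp; have hv' := L2_normr mO hv; have h1 := L2_cst mO bO 1.
have hmp := L2Z mO m hp'; have hc1 := L2Z mO c h1.
apply: (@le_trans _ _ (L2prod O (fun x => m * `|p x| + c * 1) (fun x => `|v x|))).
  apply: le_L2prod => //; first exact: L2D.
  move=> x Ox; apply: le_trans (ler_norm _) _; rewrite normrM ler_wpM2r//.
  by rewrite mulr1 wpc.
rewrite L2prodDl// !L2prodZl// mulrDl -!mulrA -(L2norm_normr p) -(L2norm_normr v).
by apply: lerD; apply: ler_wpM2l => //; exact: L2prod_le_norm.
Qed.

(** [c] bounds the regularization error uniformly; it enters the right-hand side as a constant
    function, whence the factor [L2norm O (fun=> 1)]. *)
Lemma energy_step (alpha delta eta c : R) (Rr S : R -> R) f Gam u g uprev uk gk :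
  0 <= delta -> 0 <= eta -> 0 <= c ->
  slopes_in delta Rr -> slopes_in delta S -> (forall s, `|Rr s - S s| <= c) ->
  L2 O f -> L2 O uprev ->
  weak_solution A eps alpha Rr f O Gam u g ->
  iteration_step A eps alpha (eta + eps `^ alpha * delta) S f O Gam uprev uk gk ->
  glo * L2norm_vec O (fun x => g x - gk x) ^+ 2 +
    (eta + eps `^ alpha * delta) * L2norm O (fun x => u x - uk x) ^+ 2 <=
  ((eta + eps `^ alpha * delta) * L2norm O (fun x => u x - uprev x) +
     eps `^ alpha * c * L2norm O (fun=> 1)) * L2norm O (fun x => u x - uk x).
Proof.
move=> delta0 eta0 c0 sR sS RS hf hprev [H1u weq] [H1k keq].
have t0 : 0 <= eps `^ alpha by exact: powR_ge0.
move: (eps `^ alpha) t0 weq keq => t t0 weq keq.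
have M0 : 0 <= eta + t * delta by rewrite addr_ge0// mulr_ge0.
have He := H1_0B mO bO H1u H1k.
have [[hu hg _] _] := H1u; have [[huk hgk _] _] := H1k; have [[he hh _] _] := He.
have {weq} W := weq _ _ He; have {keq} K := keq _ _ He.
have hRu := L2_slopes sR hu; have hSp := L2_slopes sS hprev.
set e := (fun x => u x - uk x) in he W K *.
set h := (fun x => g x - gk x) in hh W K *.
set M := eta + t * delta in M0 K *.
(* Subtracting the two equations tested with [e] leaves [w] as the source of the error equation. *)
pose w x := M * (u x - uprev x) - t * ((Rr \o u) x - (S \o uprev) x).
have hup := L2B mO hu hprev; have hRS := L2B mO hRu hSp.
have hw : L2 O w by apply: L2B => //; exact: L2Z.
have wbound x : O x -> `|w x| <= M * `|u x - uprev x| + t * c.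
  move=> _; rewrite /w /=.
  (* Inserting [Rr (uprev x)] separates the contraction for [Rr] from the regularization error at
     [uprev x]. *)
  rewrite (_ : _ - _ = (M * (u x - uprev x) - t * (Rr (u x) - Rr (uprev x)))
     - t * (Rr (uprev x) - S (uprev x))); last by ring.
  apply: le_trans (ler_normB _ _) _; apply: lerD; first exact: slopes_in_contraction.
  by rewrite normrM (ger0_norm t0) ler_wpM2l.
have tc0 : 0 <= t * c by exact: mulr_ge0.
apply: le_trans (L2prod_affine_bound M0 tc0 hw hup he wbound).
apply: (@le_trans _ _ (diffusion_form A eps O h h + M * L2prod O e e)).
  by rewrite sqr_L2norm lerD2r diffusion_coercive.
have -> : L2prod O w e = M * (L2prod O u e - L2prod O uprev e) -
    t * (L2prod O (Rr \o u) e - L2prod O (S \o uprev) e).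
  rewrite /w L2prodBl//; [|exact: L2Z..].
  by rewrite !L2prodZl// !L2prodBl.
have -> : L2prod O e e = L2prod O u e - L2prod O uk e by rewrite {1}/e L2prodBl.
have -> : diffusion_form A eps O h h =
    diffusion_form A eps O g h - diffusion_form A eps O gk h.
  by rewrite {1}/h diffusion_formBl.
move: W K.
move: (diffusion_form A eps O g h) (diffusion_form A eps O gk h) (L2prod O f e)
  (L2prod O u e) (L2prod O uk e) (L2prod O uprev e) (L2prod O (Rr \o u) e)
  (L2prod O (S \o uprev) e) => a1 a2 a3 a4 a5 a6 a7 a8; clear => W K.
suff -> : a1 - a2 + M * (a4 - a5) = M * (a4 - a6) - t * (a7 - a8) by [].
have -> : a1 = a3 - t * a7 by rewrite -W addrK.
have -> : a2 = a3 + M * a6 - t * a8 - M * a5 by rewrite -K addrK.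
ring.
Qed.

(** Testing with [u] itself, coercivity and Poincare's inequality bound the squared norm of [u] by a
    multiple of the norm, and one power cancels. *)
Lemma weak_solution_bound (alpha delta Cp : R) (Rr : R -> R) f Gam u g :
  0 <= delta -> 0 < Cp -> 0 <= alpha -> slopes_in delta Rr -> L2 O f ->
  poincare O Gam Cp -> weak_solution A eps alpha Rr f O Gam u g ->
  L2norm O u <= Cp / glo * (L2norm O f + `|Rr 0| * L2norm O (fun=> 1)).
Proof.
move=> delta0 Cp0 alpha0 sR hf poi [H1u /(_ _ _ H1u) W].
have glo0 : 0 < glo by have [_ _ _ _ []] := hA.
have [[hu hg _] _] := H1u; have hRu := L2_slopes sR hu.
have t0 : 0 <= eps `^ alpha by exact: powR_ge0.
have t1 : eps `^ alpha <= 1.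
  exact: powR_le1.
move: (eps `^ alpha) t0 t1 W => t t0 t1 W.
have h1 := L2_cst mO bO 1; have hu' := L2_normr mO hu.
have Rlow : - `|Rr 0| * (L2norm O (fun=> 1) * L2norm O u) <= L2prod O (Rr \o u) u.
  apply: (@le_trans _ _ (L2prod O (fun=> - `|Rr 0| * 1) (fun x => `|u x|))).
    rewrite L2prodZl// -(L2norm_normr u) ler_wnM2l ?oppr_le0//.
    exact: L2prod_le_norm.
  apply: le_L2prod => //; first exact: L2Z.
  by move=> x _; rewrite mulr1; exact: slopes_in_monotone sR.
have fu := L2prod_le_norm mO hf hu.
have Dg := diffusion_coercive hg.
have Pu := poi _ _ H1u.
have F0 := L2norm_ge0 O f; have x0 := L2norm_ge0 O u; have v0 := L2norm_ge0 O (fun=> 1).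
have r0 := normr_ge0 (Rr 0).
move: (L2norm O u) (L2norm O (fun=> 1)) `|Rr 0| (L2norm O f) (L2norm_vec O g)
  (L2prod O (Rr \o u) u) (diffusion_form A eps O g g) (L2prod O f u)
  W Rlow fu Dg Pu F0 x0 v0 r0 => x V r F y P D Q.
clear -glo0 Cp0 t0 t1 => W Rlow fu Dg Pu F0 x0 v0 r0.
have tP : - (r * (V * x)) <= t * P.
  have rVx0 : 0 <= r * (V * x) by rewrite !mulr_ge0.
  apply: le_trans (ler_wpM2l t0 Rlow).
  by rewrite mulNr mulrN lerN2 ler_piMl.
have E1 : glo * y ^+ 2 <= (F + r * V) * x.
  apply: le_trans Dg _; rewrite (_ : D = Q - t * P); last by rewrite -W addrK.
  by rewrite mulrDl -mulrA lerD// lerNl.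
have E2 : glo * x ^+ 2 <= Cp * ((F + r * V) * x).
  apply: le_trans (ler_wpM2l (ltW Cp0) E1).
  by rewrite [leRHS]mulrCA ler_wpM2l// ltW.
rewrite mulrAC ler_pdivlMr// mulrC.
have [->|xn0] := eqVneq x 0.
  by rewrite mulr0 mulr_ge0 ?addr_ge0 ?mulr_ge0// ltW.
have xp : 0 < x by rewrite lt_def xn0.
by rewrite -(ler_pM2r xp) -mulrA -expr2 -mulrA.
Qed.

End diffusion.

(** * Comparison of norms on a set and on a subset *)

Section restriction.
Context {R : realType} {d : nat}.
Variables O Omega : set 'rV[R]_d.
Hypotheses (mO : measurable O) (mOmega : measurable Omega) (OOmega : O `<=` Omega).
Implicit Types u : 'rV[R]_d -> R.

Lemma L2S u : L2 Omega u -> L2 O u.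
Proof.
move=> [mu_ iu]; split; first exact: measurable_funS mu_.
exact: integrableS iu.
Qed.

(** This replaces norms over the perforated domain by norms over [Omega], which do not depend on
    [eps]. *)
Lemma L2normS u : L2 Omega u -> L2norm O u <= L2norm Omega u.
Proof.
move=> hu; have [mu_ iu] := hu; have [_ iuO] := L2S hu.
apply: ler_wsqrtr; apply: fine_le; [exact: integrable_fin_num|exact: integrable_fin_num|].
apply: ge0_subset_integral => //; first exact: measurable_int iu.
by move=> x _; rewrite lee_fin sqr_ge0.
Qed.

End restriction.

(** * The scalar recursion satisfied by the norms of the errors and of their gradients *)

Section error_recursion.
Context {R : realType}.
Variables (glo Cp M mmax omega B E : R) (x y : nat -> R).
Hypotheses (glo0 : 0 < glo) (Cp0 : 0 < Cp) (M0 : 0 <= M) (Mmax : M <= mmax).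
Hypotheses (omega01 : 0 < omega < 1) (B0 : 0 <= B) (E0 : 0 <= E).
Hypotheses (x_ge0 : forall k, 0 <= x k) (xB : x 0%N <= B).
Hypothesis energy : forall k,
  glo * y k.+1 ^+ 2 + M * x k.+1 ^+ 2 <= (M * x k + E * omega ^+ k.+1) * x k.+1.
Hypothesis poincare_xy : forall k, x k.+1 ^+ 2 <= Cp * y k.+1 ^+ 2.

Local Notation kappa := (glo * Cp^-1).
Local Notation q := (Num.sqrt (M / (kappa + M))).
Local Notation omegabar := (omega + q).
Local Notation D := (B + E / kappa).

Let kappa0 : 0 < kappa. Proof. by rewrite divr_gt0. Qed.

Let kM0 : 0 < kappa + M. Proof. by rewrite ltr_pwDl. Qed.

(** A number in [[0, 1]] is at most its square root. *)
Lemma contraction_le_sqrt : M / (kappa + M) <= q.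
Proof.
have r0 : 0 <= M / (kappa + M) by rewrite divr_ge0// ltW.
have r1 : M / (kappa + M) <= 1 by rewrite ler_pdivrMr// mul1r lerDr ltW.
rewrite -{1}(sqr_sqrtr r0) expr2 ler_piMl ?sqrtr_ge0//.
by rewrite -sqrtr1 ler_wsqrtr.
Qed.

Lemma error_recurrence k : x k.+1 <= q * x k + E / kappa * omega ^+ k.+1.
Proof.
have /andP[w0 _] := omega01.
have rhs0 : 0 <= M * x k + E * omega ^+ k.+1.
  by rewrite addr_ge0// mulr_ge0// exprn_ge0// ltW.
(* Poincare's inequality bounds [kappa * x k.+1 ^+ 2] by the gradient term, after which one factor
   [x k.+1] cancels, unless it is zero and the claim trivial. *)
have h : (kappa + M) * x k.+1 <= M * x k + E * omega ^+ k.+1.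
  have [->|xn0] := eqVneq (x k.+1) 0; first by rewrite mulr0.
  have xp : 0 < x k.+1 by rewrite lt_def xn0 x_ge0.
  rewrite -(ler_pM2r xp) -mulrA -expr2 mulrDl; apply: le_trans (energy k).
  rewrite lerD2r -mulrA; apply: ler_wpM2l; first exact: ltW.
  by rewrite ler_pdivrMl.
apply: (@le_trans _ _ (M / (kappa + M) * x k + E / (kappa + M) * omega ^+ k.+1)).
  rewrite -[X in X * x k]mulrC -[X in X * _ ^+ _]mulrC -!mulrA -mulrDr.
  by rewrite ler_pdivlMl.
apply: lerD; first by rewrite ler_wpM2r// contraction_le_sqrt.
(* In the source term [M] is dropped from the denominator, so that its constant [E / kappa] is free
   of [eps]. *)
rewrite ler_wpM2r ?exprn_ge0 ?(ltW w0)// ler_wpM2l//.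
by rewrite lef_pV2 ?posrE// lerDl.
Qed.

(** Induction on [k]: of the two summands of [omegabar], [q] carries the previous error and [omega]
    absorbs the source, as [E / kappa <= D] and [omega <= omegabar]. The summand [B] of [D] serves
    the base case. *)
Lemma error_bound k : x k <= D * omegabar ^+ k.
Proof.
have /andP[w0 _] := omega01.
have q0 : 0 <= q by exact: sqrtr_ge0.
have Ek : 0 <= E / kappa by rewrite divr_ge0// ltW.
elim: k => [|k IH]; first by rewrite mulr1 (le_trans xB)// lerDl.
apply: le_trans (error_recurrence k) _.
have -> : D * omegabar ^+ k.+1 =
    q * (D * omegabar ^+ k) + D * (omega * omegabar ^+ k) by rewrite exprS; ring.
apply: lerD; first by rewrite ler_wpM2l.
rewrite exprS; apply: ler_pM => //.
- by rewrite mulr_ge0 ?exprn_ge0 ?(ltW w0).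
- by rewrite lerDr.
- rewrite ler_wpM2l ?(ltW w0)//.
  by rewrite lerXn2r ?nnegrE ?addr_ge0 ?(ltW w0)// lerDl.
Qed.

(* The energy estimate mixes x k and x k.+1, so it only bounds y k.+1 ^+ 2 by
   omegabar ^+ (2k+1); dividing by omega <= omegabar restores the lost power. *)
Lemma gradient_error_bound k :
  y k.+1 <= Num.sqrt ((mmax * D + E) * D / (omega * glo)) * omegabar ^+ k.+1.
Proof.
have /andP[w0 w1] := omega01.
have q0 : 0 <= q by exact: sqrtr_ge0.
have wb0 : 0 <= omegabar by rewrite addr_ge0// ltW.
have wwb : omega <= omegabar by rewrite lerDl.
have D0 : 0 <= D by rewrite addr_ge0// divr_ge0// ltW.
have wbk n : 0 <= omegabar ^+ n by exact: exprn_ge0.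
have S0 : 0 <= (mmax * D + E) * D / (omega * glo).
  apply: divr_ge0; apply: mulr_ge0 => //; [|exact: ltW|exact: ltW].
  by rewrite addr_ge0// mulr_ge0// (le_trans M0).
have rhs : omega * (M * x k + E * omega ^+ k.+1) <= (mmax * D + E) * omegabar ^+ k.+1.
  rewrite mulrDr mulrDl; apply: lerD.
    rewrite mulrCA -mulrA; apply: ler_pM => //; first by rewrite mulr_ge0// ltW.
    apply: (@le_trans _ _ (omega * (D * omegabar ^+ k))).
      by rewrite ler_wpM2l ?(ltW w0)// error_bound.
    by rewrite mulrCA ler_wpM2l// [leRHS]exprS ler_wpM2r.
  rewrite mulrCA ler_wpM2l//.
  apply: (@le_trans _ _ (omega ^+ k.+1)).
    by rewrite ler_piMl ?exprn_ge0// ltW.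
  by rewrite lerXn2r ?nnegrE// ltW.
have : omega * glo * y k.+1 ^+ 2 <= (mmax * D + E) * D * (omegabar ^+ k.+1) ^+ 2.
  rewrite -mulrA; apply: (@le_trans _ _ (omega * ((M * x k + E * omega ^+ k.+1) * x k.+1))).
    rewrite ler_wpM2l ?(ltW w0)//; apply: le_trans (energy k).
    by rewrite lerDl mulr_ge0// sqr_ge0.
  rewrite mulrA expr2 mulrACA [X in _ <= X]mulrACA.
  rewrite mulrACA; apply: ler_pM => //; last exact: error_bound.
  by rewrite mulr_ge0 ?addr_ge0 ?mulr_ge0 ?exprn_ge0// ltW.
rewrite mulrC -ler_pdivlMr ?mulr_gt0// => h.
apply: le_trans (ler_norm _) _.
rewrite -(ger0_norm (wbk k.+1)) -2!sqrtr_sqr -sqrtrM//; apply: ler_wsqrtr.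
by apply: le_trans h _; rewrite mulrAC.
Qed.

End error_recursion.

(** * Geometric decay of the regularization errors *)

Section parameters.
Context {R : realType}.
Variables (gamma : nat -> R) (sigma C0 omega : R).
Hypotheses (gamma_gt0 : forall k, (1 <= k)%N -> 0 < gamma k).
Hypotheses (gamma_le : forall k, (1 <= k)%N -> gamma k.+1 <= gamma k).
Hypotheses (omega01 : 0 < omega < 1) (C00 : 0 < C0).
Hypothesis ratio : forall k, (2 <= k)%N ->
  gamma k.-1 `^ sigma / gamma k <= C0 * omega ^+ k.

Lemma gamma_le1 k : gamma k.+1 <= gamma 1%N.
Proof. by elim: k => // k; apply: le_trans; exact: gamma_le. Qed.

(** The ratio hypothesis at index [k.+1] controls [gamma k]; then [gamma k.+1 <= gamma 1] and
    [omega ^+ k.+1 <= omega ^+ k]. *)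
Lemma gamma_powR_le_geometric k : (1 <= k)%N ->
  gamma k `^ sigma <= C0 * gamma 1%N * omega ^+ k.
Proof.
have /andP[w0 w1] := omega01.
move=> k1; have := ratio (k := k.+1) k1.
rewrite ler_pdivrMr ?gamma_gt0//= => /le_trans; apply.
rewrite -!mulrA ler_wpM2l ?(ltW C00)// [leRHS]mulrC.
apply: ler_pM; rewrite ?exprn_ge0 ?(ltW w0) ?(ltW (gamma_gt0 _))//; last exact: gamma_le1.
by rewrite exprS ler_piMl ?exprn_ge0 ?(ltW w0) ?(ltW w1).
Qed.

End parameters.

(** * Assembly of the estimates with constants uniform in [eps] and [k] *)

Theorem corollary1 (R : realType) (d : nat) (hd : d = 2%N \/ d = 3%N)
    (Omega T : set 'rV[R]_d) (K : R -> set 'rV[int]_d)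
    (hOmega : bounded_polyhedral_domain Omega)
    (hT : is_hole T)
    (hK : perforation Omega T K)
    (Cp : R) (hCp0 : 0 < Cp)
    (hCp : forall eps : R, 0 < eps < 1 ->
       poincare (perforated eps (K eps) Omega T) (boundary Omega) Cp)
    (A : 'rV[R]_d -> 'M[R]_d) (glo ghi : R)
    (hA : admissible_coefficient A glo ghi)
    (Rr : R -> R) (x0 delta0 delta1 : R)
    (hRr : degenerate_at Rr x0 delta0 delta1)
    (f : 'rV[R]_d -> R) (hf : L2 Omega f)
    (alpha : R) (halpha : 0 <= alpha)
    (gamma : nat -> R)
    (hgamma0 : forall k, (1 <= k)%N -> 0 < gamma k)
    (hgamma : forall k, (1 <= k)%N -> gamma k.+1 <= gamma k)
    (Rg : nat -> R -> R) (sigma CR : R) (hsigma : 0 < sigma) (hCR : 0 < CR)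
    (hRg : forall k, (1 <= k)%N ->
       regularization Rr delta0 delta1 sigma CR (gamma k) (Rg k))
    (eta : R) (heta : 0 < eta)
    (omega C0 : R) (homega : 0 < omega < 1) (hC0 : 0 < C0)
    (hratio : forall k, (2 <= k)%N ->
       gamma k.-1 `^ sigma / gamma k <= C0 * omega ^+ k) :
  exists C : R, 0 < C /\
    forall eps : R, 0 < eps < 1 ->
      let O := perforated eps (K eps) Omega T in
      let M := eta + eps `^ alpha * delta1 in
      let omegabar := omega + Num.sqrt (M / (glo * Cp^-1 + M)) in
      omegabar < 1 ->
      forall (u : 'rV[R]_d -> R) (g : 'rV[R]_d -> 'rV[R]_d)
             (uk : nat -> 'rV[R]_d -> R) (gk : nat -> 'rV[R]_d -> 'rV[R]_d),
        weak_solution A eps alpha Rr f O (boundary Omega) u g ->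
        iterates A eps alpha M Rg f O (boundary Omega) uk gk ->
        forall k, (1 <= k)%N ->
          Num.sqrt (glo / (eta + delta1 + glo * Cp^-1)) *
            L2norm_vec O (fun x => g x - gk k x) +
          L2norm O (fun x => u x - uk k x)
          <= C * omegabar ^+ k / (1 - omegabar).
Proof.
have [_ oOmega _ bOmega _] := hOmega; have [_ cT _ _] := hT.
have [delta1_gt0 _ _ _] := hRr; have glo0 : 0 < glo by have [_ _ _ _ []] := hA.
have /andP[w0 w1] := homega.
have mOmega := open_measurable_rV oOmega.
have gle := gamma_powR_le_geometric hgamma0 hgamma homega hC0 hratio.
have sRg k : (1 <= k)%N -> slopes_in delta1 (Rg k).
  by move=> /hRg; exact: regularization_slopes.
have g1 : 0 < gamma 1%N by exact: hgamma0.
have Rdist k : (1 <= k)%N -> forall s, `|Rr s - Rg k s| <= CR * (gamma k `^ sigma).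
  by move=> /hRg[_].
have cg0 : 0 <= CR * (C0 * gamma 1%N) by rewrite !mulr_ge0// ltW.
have sR : slopes_in delta1 Rr.
  apply: (slopes_in_limit cg0 homega sRg) => k k1 s.
  by apply: le_trans (Rdist k k1 s) _; rewrite -mulrA ler_wpM2l ?(ltW hCR)// gle.
(* All constants are fixed before [eps]: norms are taken over [Omega], and in [Y] the bound
   [eta + delta1] stands for [M]. *)
pose V := L2norm Omega (fun=> 1); pose F := L2norm Omega f.
have V0 : 0 <= V by exact: L2norm_ge0.
have F0 : 0 <= F by exact: L2norm_ge0.
pose B := Cp / glo * (F + `|Rr 0| * V); pose E := CR * (C0 * gamma 1%N) * V.
have B0 : 0 <= B by rewrite mulr_ge0 ?divr_ge0 ?addr_ge0 ?mulr_ge0// ltW.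
have E0 : 0 <= E by exact: mulr_ge0.
pose D := B + E / (glo * Cp^-1).
have D0 : 0 <= D by rewrite addr_ge0// divr_ge0// divr_ge0// ltW.
pose Y := Num.sqrt (((eta + delta1) * D + E) * D / (omega * glo)).
pose s := Num.sqrt (glo / (eta + delta1 + glo * Cp^-1)).
have sY0 : 0 <= s * Y by rewrite mulr_ge0 ?sqrtr_ge0.
(* [s * Y] accounts for the weighted gradient and [D] for the function itself; adding 1 makes the
   constant strictly positive. *)
exists (s * Y + D + 1); split; first by rewrite ltr_wpDl// addr_ge0.
move=> eps eps01 O M omegabar wb1 u g uk gk hu [uk0 hk].
have mO : measurable O by exact: measurable_perforated.
have OOmega : O `<=` Omega by move=> x [].
have bO : bounded_set O.
  by have [r hr] := bounded_set_norm_le bOmega; exists r; split;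
    rewrite ?num_real// => t /ltW rt x /OOmega/hr xr; exact: le_trans xr rt.
have hfO : L2 O f by exact: L2S hf.
have t0 : 0 <= eps `^ alpha by exact: powR_ge0.
have t1 := powR_le1 eps01 halpha.
have M0 : 0 <= M by rewrite addr_ge0 ?mulr_ge0// ltW.
have Mmax : M <= eta + delta1 by rewrite lerD2l ler_piMl// ltW.
have VO : L2norm O (fun=> 1) <= V.
  by apply: L2normS => //; exact: L2_cst.
have huk k : L2 O (uk k).
  case: k => [|k]; first by rewrite uk0; exact: L2_cst.
  by have [[[]]] := hk k.+1 isT.
pose x k := L2norm O (fun z => u z - uk k z).
pose y k := L2norm_vec O (fun z => g z - gk k z).
have x_ge0 k : 0 <= x k by exact: L2norm_ge0.
have xB : x 0%N <= B.
  (* The iteration starts from zero, so the initial error is [u]. *)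
  rewrite /x uk0 (_ : (fun z => _) = u); last by apply/funext => z; rewrite subr0.
  have := weak_solution_bound mO bO eps01 hA (ltW delta1_gt0) hCp0 halpha sR hfO
    (hCp eps eps01) hu.
  move=> /le_trans; apply.
  rewrite ler_wpM2l ?divr_ge0 ?(ltW hCp0) ?(ltW glo0)//.
  apply: lerD; first exact: L2normS.
  by rewrite ler_wpM2l.
have energy k :
    glo * y k.+1 ^+ 2 + M * x k.+1 ^+ 2 <= (M * x k + E * omega ^+ k.+1) * x k.+1.
  have c0 : 0 <= CR * (gamma k.+1 `^ sigma) by rewrite mulr_ge0 ?powR_ge0// ltW.
  apply: le_trans (energy_step mO bO eps01 hA (ltW delta1_gt0) (ltW heta) c0 sR
    (sRg k.+1 isT) (Rdist k.+1 isT) hfO (huk k) hu (hk k.+1 isT)) _.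
  apply: ler_wpM2r; first exact: x_ge0.
  (* The source is at most [E * omega ^+ k.+1] by [eps]^ alpha <= 1[, the decay of]gamma k.+1
     [^ sigma] and [VO]. *)
  apply: lerD => //; rewrite /E [leRHS]mulrAC.
  apply: ler_pM => //; rewrite ?mulr_ge0 ?powR_ge0 ?L2norm_ge0 ?(ltW hCR)//.
  apply: (@le_trans _ _ (CR * gamma k.+1 `^ sigma)); first by rewrite ler_piMl.
  by rewrite -mulrA ler_wpM2l ?(ltW hCR)// gle.
have poi k : x k.+1 ^+ 2 <= Cp * y k.+1 ^+ 2.
  by apply: (hCp eps eps01); apply: H1_0B => //; [exact: hu.1|exact: (hk k.+1 isT).1].
have wb0 : 0 <= omegabar by rewrite addr_ge0 ?sqrtr_ge0// ltW.
case=> // k _.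
have xk := error_bound glo0 hCp0 M0 homega B0 E0 x_ge0 xB energy poi k.+1.
have yk := gradient_error_bound glo0 hCp0 M0 Mmax homega B0 E0 x_ge0 xB energy poi k.
rewrite -/(x k.+1) -/(y k.+1) -/s -/omegabar -/D -/Y in xk yk *.
have wk : 0 <= omegabar ^+ k.+1 by exact: exprn_ge0.
have wb : 0 < 1 - omegabar by rewrite subr_gt0.
(* Since [0 < 1 - omegabar <= 1], dividing by it only enlarges the bound. *)
apply: (@le_trans _ _ ((s * Y + D + 1) * omegabar ^+ k.+1)); last first.
  rewrite ler_pdivlMr// ler_piMr ?gerBl// mulr_ge0// addr_ge0// addr_ge0//.
apply: (@le_trans _ _ (s * (Y * omegabar ^+ k.+1) + D * omegabar ^+ k.+1)).
  by apply: lerD => //; rewrite ler_wpM2l ?sqrtr_ge0.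
by rewrite mulrA -mulrDl ler_wpM2r// lerDl.
Qed.
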